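(* Let $N\ge 1$ be an integer, $R>0$, $\sigma\neq 0$ a real constant, and let $B_R(0)\subset\mathbb{R}^N$ be the ball of radius $R$ centered at the origin. Given a constant $\alpha>0$, there exists a unique positive radially symmetric solution $u_\alpha\in C^2[0,R]$ (written as a function of $r=|x|$) of the problem $$\Delta u(x)=\frac{1}{\sigma^4}|x|^2u(x)\ \text{ in } B_R(0),\qquad u(0)=\alpha .$$ Moreover, $r\mapsto u_\alpha(r)$ is convex and increasing on $[0,R]$, it satisfies $u_\alpha'(0)=0$, and for all $r\in[0,R]$ $$u_\alpha(r)=\alpha\left(1+\sum_{j=1}^{\infty}\frac{1}{j!\,(N+2)(N+6)\cdots(N+4j-2)}\left(\frac{r^2}{2\sigma^2}\right)^{2j}\right),$$ $$u_\alpha'(r)=\alpha\sum_{j=1}^{\infty}\frac{4jr}{2\sigma^2\,j!\,(N+2)(N+6)\cdots(N+4j-2)}\left(\frac{r^2}{2\sigma^2}\right)^{2j-1}.$$ In addition, for all $r\in[0,R]$, $$u_\alpha(r)\le \alpha\, e^{\frac{r^4}{4\sigma^4(N+2)}},\qquad u_\alpha'(r)\le \frac{\alpha r^3}{\sigma^4(N+2)}\,e^{\frac{r^4}{4\sigma^4(N+2)}} .$$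
   Context: $|\cdot|$ is the Euclidean norm on $\mathbb{R}^N$ and $\Delta$ the Laplacian. A radially symmetric solution is a classical solution of the form $x\mapsto u(|x|)$, identified with its profile $r\mapsto u(r)$ on $[0,R]$; the profile satisfies $u''(r)+\frac{N-1}{r}u'(r)=\frac{1}{\sigma^4}r^2u(r)$. The product $(N+2)(N+6)\cdots(N+4j-2)$ is $\prod_{i=1}^{j}(N+4i-2)$. *)

(* Defs.v *)
From mathcomp Require Import all_boot all_order all_algebra.
From mathcomp Require Import all_classical all_reals all_analysis.

Set Implicit Arguments.
Unset Strict Implicit.
Unset Printing Implicit Defensive.

Import Order.TTheory GRing.Theory Num.Theory.
Import numFieldNormedType.Exports.

Local Open Scope classical_set_scope.
Local Open Scope ring_scope.

(* The norm that MathComp-Analysis puts on ['rV[R]_N] is the sup norm; the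
   Euclidean norm is needed for radial symmetry. Both give the same topology,
   so continuity and derivatives on ['rV[R]_N] are the usual ones. *)
Definition enorm (R : realType) (N : nat) (x : 'rV[R]_N) : R :=
  Num.sqrt (\sum_(i < N) x 0 i ^+ 2).

Definition eball (R : realType) (N : nat) (rad : R) : set 'rV[R]_N :=
  [set x | enorm x < rad].

Definition partial (R : realType) (N : nat) (i : 'I_N) (w : 'rV[R]_N -> R) :
    'rV[R]_N -> R :=
  fun x => 'D_(delta_mx 0 i) w x.

(* To be used for open [D]: the derivatives are full ones, not relative to
   [D]. *)
Definition C2_open (R : realType) (N : nat) (D : set 'rV[R]_N)
    (w : 'rV[R]_N -> R) : Prop :=
  [/\ forall x, D x -> {for x, continuous w},
      forall i x, D x ->
        derivable w x (delta_mx 0 i) /\ {for x, continuous (partial i w)}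
    & forall i j x, D x ->
        derivable (partial i w) x (delta_mx 0 j) /\
        {for x, continuous (partial j (partial i w))}].

Definition laplacian (R : realType) (N : nat) (w : 'rV[R]_N -> R)
    (x : 'rV[R]_N) : R :=
  \sum_(i < N) partial i (partial i w) x.

(* Derivative relative to [A]: the difference quotient is only taken over
   points of [A]. For [A = `[0, rad]] it is the ordinary derivative at interior
   points, the one-sided derivative at the endpoints, and it does not depend on
   the values of [f] outside [A]. *)
Definition diff_quot (R : realType) (f : R -> R) (x y : R) : R :=
  (f y - f x) / (y - x).

Definition derivable_in (R : realType) (A : set R) (f : R -> R) (x : R) : Prop :=
  cvg (diff_quot f x y @[y --> within A x^']).

Definition derive_in (R : realType) (A : set R) (f : R -> R) (x : R) : R :=
  lim (diff_quot f x y @[y --> within A x^']).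

Definition C2_itv (R : realType) (a b : R) (f : R -> R) : Prop :=
  let I := `[a, b]%classic in
  [/\ forall x, I x -> derivable_in I f x,
      forall x, I x -> derivable_in I (derive_in I f) x
    & {within I, continuous (derive_in I (derive_in I f))}].

(* A profile is a total function [u : R -> R]; only its values on [0, rad]
   matter. The equation is the N-dimensional one for [x |-> u (|x|)], origin
   included. *)
Definition positive_radial_solution (R : realType) (N : nat)
    (rad sigma alpha : R) (u : R -> R) : Prop :=
  let w := fun x : 'rV[R]_N => u (enorm x) in
  [/\ C2_itv 0 rad u,
      C2_open (@eball R N rad) w,
      forall x, eball rad x ->
        laplacian w x = 1 / sigma ^+ 4 * enorm x ^+ 2 * w x,
      u 0 = alpha
    & forall r, r \in `[0, rad] -> 0 < u r].

(* [j! (N + 2)(N + 6) ... (N + 4j - 2)] *)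
Definition den (R : realType) (N j : nat) : R :=
  j`!%:R * \prod_(1 <= i < j.+1) (N%:R + 4 * i%:R - 2).

Definition profile_term (R : realType) (N : nat) (sigma r : R) (j : nat) : R :=
  1 / den R N j * (r ^+ 2 / (2 * sigma ^+ 2)) ^+ (2 * j).

Definition dprofile_term (R : realType) (N : nat) (sigma r : R) (j : nat) : R :=
  (4 * j%:R * r) / (2 * sigma ^+ 2 * den R N j) *
  (r ^+ 2 / (2 * sigma ^+ 2)) ^+ (2 * j - 1).

(* Main.v *)
Require Import Defs.
From mathcomp Require Import all_boot all_order all_algebra.
From mathcomp Require Import all_classical all_reals all_analysis.
From mathcomp Require Import ring lra.

Import Order.TTheory GRing.Theory Num.Theory.
Import numFieldNormedType.Exports.

Local Open Scope classical_set_scope.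
Local Open Scope ring_scope.

(** With [S = x_1^2 + ... + x_N^2], [z = S^2 / (4 sigma^4)] and
    [H z = \sum_j z^j / den_j], the function [alpha * H z] solves the PDE on the
    whole space because comparing coefficients gives [4 z H'' + (N + 2) H' = H].
    Since [den_j >= j! (N + 2)^j], the series of [H], [H'] and [H''] are dominated
    by exponential series; this gives smoothness and the two upper bounds, while
    the positivity of the coefficients gives monotonicity and convexity.

    For uniqueness, a radial solution [v] satisfies the profile ODE on [(0, rad)],
    and [v' 0 = 0] because [h |-> v |h|] is even and derivable at [0]. The
    difference [d] of two solutions then has [d 0 = d' 0 = 0], and
    [(d^2 + d'^2) exp (- C r)] is nonincreasing for [C] large: the singular term
    [- (N - 1) / r * d'] has the favourable sign. *)

(** * Power series with coefficients bounded by 1/j! *)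

Section factorially_bounded_series.
Variable R : realType.
Implicit Types (c : R ^nat) (a b x : R).

Definition psum c x : R := limn (pseries c x).

(** A bound that forces convergence on the whole line and survives termwise differentiation, so that
    series can be differentiated repeatedly with no radius to track. *)
Definition fact_bounded c := forall j, `|c j| <= (j`!%:R)^-1.

(** The factor [j.+1] produced by differentiation cancels against (j+1)!. *)
Lemma fact_bounded_diffs c : fact_bounded c -> fact_bounded (pseries_diffs c).
Proof.
move=> cb j; rewrite /pseries_diffs normrM normr_nat.
apply: (le_trans (ler_wpM2l (ler0n _ _) (cb j.+1))).
by rewrite factS natrM invfM mulVKf// pnatr_eq0.
Qed.

Lemma is_cvg_pseries_fact c x : fact_bounded c -> cvgn (pseries c x).
Proof.
move=> cb; apply: normed_cvg.
apply: (@series_le_cvg _ _ (exp_coeff `|x|)) => [n|n|n|].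
- exact: normr_ge0.
- exact: exp_coeff_ge0.
- by rewrite /= normrM normrX mulrC ler_wpM2l// exprn_ge0.
- exact: is_cvg_series_exp_coeff.
Qed.

Lemma is_derive_psum c x :
  fact_bounded c -> is_derive x 1 (psum c) (psum (pseries_diffs c) x).
Proof.
move=> cb; have cb1 := fact_bounded_diffs _ cb.
have cb2 := fact_bounded_diffs _ cb1.
(* Any radius above [|x|] would do, as all the series converge everywhere. *)
apply: (@pseries_snd_diffs _ c (`|x| + 1)); try exact: is_cvg_pseries_fact.
by rewrite [ltRHS]ger0_norm ?addr_ge0// ltrDl.
Qed.

Lemma psum0 c : psum c 0 = c 0%N.
Proof.
(* The shift discards the empty partial sum, the only one different from [c 0]. *)
apply: cvg_lim => //; rewrite -(cvg_shiftS (pseries c 0)).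
have -> : (fun n => pseries c 0 n.+1) = cst (c 0%N).
  apply/funext => n; rewrite /pseries /series/= big_ltn// expr0 mulr1.
  by rewrite big_add1/= big1 ?addr0// => j _; rewrite expr0n mulr0.
exact: cvg_cst.
Qed.

(** Source of the signs of the solution and of its first two derivatives. *)
Lemma psum_ge_coef0 c x :
  fact_bounded c -> (forall j, 0 <= c j) -> 0 <= x -> c 0%N <= psum c x.
Proof.
move=> cb c0 x0; apply: limr_ge; first exact: is_cvg_pseries_fact.
near=> n; have n0 : (0 < n)%N by near: n; exists 1%N.
rewrite /pseries /series /= big_ltn// expr0 mulr1 lerDl.
by apply: sumr_ge0 => i _; rewrite mulr_ge0// exprn_ge0.
Unshelve. all: by end_near. Qed.

(** Source of both exponential bounds: the right-hand coefficients are those of a * exp (b x). *)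
Lemma psum_le_expR c a b x : fact_bounded c -> 0 <= x ->
  (forall j, c j <= a * (b ^+ j / j`!%:R)) -> psum c x <= a * expR (b * x).
Proof.
move=> cb x0 cab.
have cve : a * series (exp_coeff (b * x)) n @[n --> \oo] --> a * expR (b * x).
  by apply: cvgMr; exact: is_cvg_series_exp_coeff.
rewrite -(cvg_lim _ cve)//; apply: ler_lim.
- exact: is_cvg_pseries_fact.
- by apply/cvg_ex; exists (a * expR (b * x)).
- near=> n; rewrite /pseries /series /= mulr_sumr; apply: ler_sum => j _.
  rewrite /exp_coeff /= exprMn -mulrA [X in a * X](_ : _ = (b ^+ j / j`!%:R) * x ^+ j); last by ring.
  by rewrite mulrA ler_wpM2r ?exprn_ge0.
Unshelve. all: by end_near. Qed.

Lemma continuous_psum c : fact_bounded c -> continuous (psum c).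
Proof.
by move=> cb x; apply/differentiable_continuous/derivable1_diffP;
  have [] := is_derive_psum c x cb.
Qed.

End factorially_bounded_series.

(** * The series H: coefficient bounds and differential equation *)

Section profile_series.
Variables (R : realType) (N : nat).

Definition profile_coef (j : nat) : R := (den R N j)^-1.

Lemma denS j : den R N j.+1 = j.+1%:R * (N%:R + 4 * j%:R + 2) * den R N j.
Proof.
rewrite /den big_nat_recr//= factS natrM.
rewrite [X in _ * (_ * X)](_ : _ = N%:R + 4 * j%:R + 2); first by ring.
by rewrite -natr1; ring.
Qed.

Lemma den0 : den R N 0 = 1.
Proof. by rewrite /den big_geq// fact0 mulr1. Qed.

(** Each factor N + 4i - 2 with i >= 1 is at least N + 2. *)
Lemma den_ge j : j`!%:R * (N%:R + 2) ^+ j <= den R N j :> R.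
Proof.
elim: j => [|j IH]; first by rewrite den0 fact0 expr0 mulr1.
rewrite denS factS natrM exprS.
rewrite [leLHS](_ : _ = j.+1%:R * (N%:R + 2) * (j`!%:R * (N%:R + 2) ^+ j)); last by ring.
apply: ler_pM IH; rewrite ?mulr_ge0 ?exprn_ge0 ?addr_ge0//.
by apply: ler_wpM2l => //; have := ler0n R j; lra.
Qed.

Lemma den_gt0 j : 0 < den R N j.
Proof.
apply: lt_le_trans (den_ge j).
by rewrite mulr_gt0 ?ltr0n ?fact_gt0// exprn_gt0// ltr_wpDl.
Qed.

Lemma profile_coef_gt0 j : 0 < profile_coef j.
Proof. by rewrite invr_gt0 den_gt0. Qed.

Lemma profile_coef_le j : profile_coef j <= (N%:R + 2)^-1 ^+ j / j`!%:R.
Proof.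
rewrite exprVn -invfM lef_pV2 ?posrE ?den_gt0 ?mulr_gt0 ?exprn_gt0 ?ltr0n ?fact_gt0 ?ltr_wpDl//.
by rewrite mulrC den_ge.
Qed.

Lemma fact_bounded_profile_coef : fact_bounded _ profile_coef.
Proof.
move=> j; rewrite ger0_norm ?(ltW (profile_coef_gt0 j))//.
apply: (le_trans (profile_coef_le j)).
rewrite ler_piMl ?invr_ge0// exprn_ile1 ?invr_ge0 ?addr_ge0//.
by rewrite invf_le1 ?ltr_wpDl// (le_trans (_ : 1 <= 2))// ?ler1n// lerDr.
Qed.

Let c := profile_coef.
Let dc := pseries_diffs c.
Let ddc := pseries_diffs dc.

Lemma pseries_diffs_ge0 (e : R ^nat) :
  (forall j, 0 <= e j) -> forall j, 0 <= pseries_diffs e j.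
Proof. by move=> e0 j; rewrite mulr_ge0. Qed.

(** Differentiation cancels j+1 and leaves one extra factor 1/(N+2), the one in front of the
    exponential in the bound on u'. *)
Lemma dprofile_coef_le j :
  pseries_diffs profile_coef j <= (N%:R + 2)^-1 * ((N%:R + 2)^-1 ^+ j / j`!%:R).
Proof.
rewrite /pseries_diffs.
apply: (le_trans (ler_wpM2l (ler0n _ _) (profile_coef_le j.+1))).
rewrite factS natrM invfM exprS.
have j1 : j.+1%:R != 0 :> R by rewrite pnatr_eq0.
rewrite [leLHS](_ : _ = j.+1%:R / j.+1%:R *
  ((N%:R + 2)^-1 * ((N%:R + 2)^-1 ^+ j / j`!%:R))); last by ring.
by rewrite divff// mul1r.
Qed.

(** This is 4 z H'' + (N + 2) H' = H, proved on partial sums and passed to the limit. *)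
Lemma profile_series_ode (z : R) :
  4 * z * psum _ ddc z + (N%:R + 2) * psum _ dc z = psum _ c z.
Proof.
have cb := fact_bounded_profile_coef.
have cb1 := fact_bounded_diffs _ _ cb; have cb2 := fact_bounded_diffs _ _ cb1.
have C0 := is_cvg_pseries_fact _ _ z cb.
have C1 := is_cvg_pseries_fact _ _ z cb1.
have C2 := is_cvg_pseries_fact _ _ z cb2.
have pserS (e : R ^nat) n : pseries e z n.+1 = pseries e z n + e n * z ^+ n.
  by rewrite /pseries /series/= big_nat_recr.
(* Multiplication by z raises degrees by one, so H'' is cut one term earlier than H and H'; the
   truncated identity is then exact. *)
have E n : pseries c z n.+1 =
    4 * z * pseries ddc z n + (N%:R + 2) * pseries dc z n.+1.
  elim: n => [|n IH].
    rewrite /pseries /series/= !big_nat1 big_geq// mulr0 add0r expr0 !mulr1.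
    rewrite /dc /pseries_diffs /c /profile_coef denS den0 invr1.
    have := ler0n R N; move: (N%:R) => n n0.
    field; rewrite !gt_eqF//; lra.
  rewrite pserS IH (pserS dc n.+1) (pserS ddc n).
  (* Coefficient recursion: [dc n.+1] is (n+2) [c n.+2], and [denS] relates [c n.+2] to [c n.+1]. *)
  have -> : c n.+1 = (4 * n.+1%:R + (N%:R + 2)) * dc n.+1.
    rewrite /dc /pseries_diffs /c /profile_coef [den R N n.+2]denS.
    have := ler0n R N; move: (N%:R) => m m0.
    have := den_gt0 n.+1; move: (den R N n.+1) => D D0.
    have := ltr0Sn R n.+1; have := ltr0Sn R n; move: (n.+1%:R) (n.+2%:R) => k k' k0 k'0.
    field; rewrite !gt_eqF//; lra.
  by rewrite /ddc /pseries_diffs exprS; ring.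
have L : pseries c z n.+1 @[n --> \oo] -->
    4 * z * psum _ ddc z + (N%:R + 2) * psum _ dc z.
  under eq_fun do rewrite E.
  apply: cvgD; apply: cvgMr => //.
  have := C1; rewrite -(cvg_shiftS (pseries dc z)); exact.
have L' : pseries c z n.+1 @[n --> \oo] --> psum _ c z.
  by rewrite (cvg_shiftS (pseries c z)).
exact: (cvg_unique _ L L').
Qed.

End profile_series.

(** * Derivatives relative to a segment versus ordinary derivatives *)

Section derivative_relative_to_segment.
Variables (R : realType) (a b : R).
Hypothesis ab : a < b.
Let I : set R := `[a, b]%classic.
Implicit Types (f g : R -> R) (x l : R).

(** Makes relative limits unique. A point below b is approached from the right; b itself from the
    left, since a < b. *)
Lemma within_itv_dnbhs_proper x : I x -> ProperFilter (within I x^').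
Proof.
rewrite /I /= in_itv/= => /andP[ax xb].
apply: Build_ProperFilter_ex => P.
rewrite /within /dnbhs /= near_withinE => IP.
have [xltb|blex] := ltP x b.
  have H0 : ProperFilter x^'+ by exact: at_right_proper_filter.
  suff H : \forall y \near x^'+, P y.
    exact: (@filter_ex _ _ H0 _ H).
  near=> y; have xy : x < y by near: y; exact: nbhs_right_gt.
  suff : y != x -> I y -> P y.
    apply; first by rewrite gt_eqF.
    rewrite /I /= in_itv/= (le_trans ax (ltW xy))/=.
    by near: y; exact: nbhs_right_le.
  by near: y; exact: cvg_within.
have altx : a < x by rewrite (lt_le_trans ab).
have H0 : ProperFilter x^'- by exact: at_left_proper_filter.
suff H : \forall y \near x^'-, P y.
  exact: (@filter_ex _ _ H0 _ H).
near=> y; have yx : y < x by near: y; exact: nbhs_left_lt.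
suff : y != x -> I y -> P y.
  apply; first by rewrite lt_eqF.
  rewrite /I /= in_itv/= (le_trans (ltW yx) xb) andbT.
  by near: y; exact: nbhs_left_ge.
by near: y; exact: cvg_within.
Unshelve. all: by end_near. Qed.

Lemma derive_inP f x l : I x -> diff_quot f x y @[y --> within I x^'] --> l ->
  derivable_in I f x /\ derive_in I f x = l.
Proof.
move=> Ix fl; have PF := within_itv_dnbhs_proper _ Ix.
by split; [apply/cvg_ex; exists l | exact: cvg_lim].
Qed.

Lemma eq_diff_quot_cvg f g x l : I x -> {in I, f =1 g} ->
  diff_quot f x y @[y --> within I x^'] --> l ->
  diff_quot g x y @[y --> within I x^'] --> l.
Proof.
move=> Ix fg; apply: cvg_trans; apply: near_eq_cvg.
rewrite near_withinE; near=> y => Iy.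
by rewrite /diff_quot !fg// inE.
Unshelve. all: by end_near. Qed.

Lemma is_derive_diff_quot f x l : is_derive x 1 f l ->
  diff_quot f x y @[y --> x^'] --> l.
Proof.
move=> /is_derive1_caratheodory[g [fg gc gx]].
rewrite -gx; apply: cvg_trans ((continuous_withinNx _ _).1 gc).
apply: near_eq_cvg; rewrite near_withinE; near=> y => /= yx.
by rewrite /diff_quot fg mulfK// subr_eq0.
Unshelve. all: by end_near. Qed.

Lemma is_derive_derive_in f x l : I x -> is_derive x 1 f l ->
  derivable_in I f x /\ derive_in I f x = l.
Proof.
move=> Ix fl; apply: derive_inP => //.
by apply: cvg_within_filter; exact: is_derive_diff_quot.
Qed.

Lemma derivable_in_is_derive f x : a < x < b -> derivable_in I f x ->
  is_derive x 1 f (derive_in I f x).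
Proof.
move=> /andP[ax xb] fx; apply/is_derive1_caratheodory.
(* The Carathéodory slope: the difference quotient, completed at [x] by the relative derivative.
   Near an interior point, membership in the segment is automatic. *)
exists (fun z => if z == x then derive_in I f x else diff_quot f x z); split.
- move=> z; case: eqP => [->|/eqP zx]; first by rewrite !subrr mulr0.
  by rewrite /diff_quot divfK// subr_eq0.
- apply/continuous_withinNx; rewrite eqxx.
  have fxc : diff_quot f x y @[y --> within I x^'] --> derive_in I f x by exact: fx.
  apply: cvg_trans fxc => P.
  rewrite /fmap /= /within /dnbhs /= !near_simpl !near_withinE => H.
  near=> y => yx; rewrite (negbTE yx).
  have : I y.
    rewrite /I /= in_itv/=.
    by apply/andP; split; apply: ltW; near: y; [exact: lt_nbhsr|exact: lt_nbhsl].
  by move: yx; near: y.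
- by rewrite eqxx.
Unshelve. all: by end_near. Qed.

Lemma derivable_in_continuous f x : I x -> derivable_in I f x ->
  f y @[y --> within I x^'] --> f x.
Proof.
move=> Ix fx; have PF := within_itv_dnbhs_proper _ Ix.
(* Off [x], f y is the quotient times y - x, plus f x; the quotient converges and y - x tends to
   0. *)
have E : (fun y => diff_quot f x y * (y - x) + f x) y @[y --> within I x^'] -->
    derive_in I f x * (x - x) + f x.
  apply: cvgD; last exact: cvg_cst.
  apply: cvgM; first exact: fx.
  apply: cvgB; last exact: cvg_cst.
  by do 2 apply: cvg_within_filter; exact: cvg_id.
rewrite subrr mulr0 add0r in E; apply: cvg_trans E.
apply: near_eq_cvg; rewrite near_withinE /dnbhs near_withinE; near=> y => yx _.
by rewrite /diff_quot divfK ?subrK// subr_eq0.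
Unshelve. all: by end_near. Qed.

Lemma derivable_in_within_continuous f :
  (forall x, I x -> derivable_in I f x) -> {within I, continuous f}.
Proof.
move=> df; apply/subspace_continuousP => x Ix.
have := derivable_in_continuous _ _ Ix (df _ Ix).
move=> fx P Pfx; have := fx _ Pfx.
rewrite /fmap /= /within /dnbhs /= !near_simpl !near_withinE => H.
near=> y => Iy.
(* The punctured limit is silent at [x], where the claim is trivial. *)
have [->|yx] := eqVneq y x; first exact: nbhs_singleton.
by move: Iy; move: yx; near: y.
Unshelve. all: by end_near. Qed.

End derivative_relative_to_segment.

(** * Directional derivatives and the chain rule *)

Lemma is_derive_lineP (R : numFieldType) (V W : normedModType R)
    (f : V -> W) (x v : V) (l : W) :
  is_derive x v f l <-> is_derive (0 : R) 1 (fun h => f (h *: v + x)) l.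
Proof.
have E : (fun h : R => h^-1 *: (f (h *: v + x) - f x)) =
    (fun h : R => h^-1 *: (f ((h *: (1 : R) + 0) *: v + x) - f (0 *: v + x))).
  by apply/funext => h; rewrite addr0 scale0r add0r [_%:A]mulr1.
split=> -[dfx <-]; apply: DeriveDef.
- by move: dfx; rewrite /derivable /= E.
- by rewrite /derive /= -E.
- by move: dfx; rewrite /derivable /= -E.
- by rewrite /derive /= E.
Qed.

(** Restricting to the line through [x] along [v] reduces this to the one-variable chain rule. *)
Lemma is_derive_comp1 (R : realType) (V : normedModType R) (f : V -> R)
    (g : R -> R) (x v : V) (a b : R) :
  is_derive (f x) 1 g a -> is_derive x v f b ->
  is_derive x v (fun y => g (f y)) (a * b).
Proof.
move=> Dg /is_derive_lineP Df; apply/is_derive_lineP.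
apply: (@is_derive1_comp _ g (fun h => f (h *: v + x))) => //.
by rewrite scale0r add0r.
Qed.

(** * Calculus of functions of the squared Euclidean norm *)

Section radial_functions.
Variables (R : realType) (N : nat).
Implicit Types (x y : 'rV[R]_N) (g : R -> R).

(** Radial functions are written in this variable because, unlike [enorm], it is smooth at the
    origin. *)
Definition sqnorm x : R := \sum_(i < N) x 0 i ^+ 2.

Lemma sqnorm_ge0 x : 0 <= sqnorm x.
Proof. by apply: sumr_ge0 => i _; exact: sqr_ge0. Qed.

Lemma enorm_sqr x : enorm x ^+ 2 = sqnorm x.
Proof. by rewrite sqr_sqrtr// sqnorm_ge0. Qed.

Lemma is_derive_coord x v (i : 'I_N) :
  is_derive x v (fun y : 'rV[R]_N => y 0 i) (v 0 i).
Proof.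
apply/is_derive_lineP.
have -> : (fun h : R => (h *: v + x) 0 i) = (fun h => h * v 0 i + x 0 i).
  by apply/funext => h; rewrite !mxE.
by apply: is_derive_eq; rewrite /GRing.scale/=; ring.
Qed.

Lemma is_derive_sqnorm x (j : 'I_N) :
  is_derive x (delta_mx 0 j) sqnorm (2 * x 0 j).
Proof.
have -> : sqnorm = \sum_(i < N) (fun y : 'rV[R]_N => y 0 i ^+ 2).
  by apply/funext => y; rewrite fct_sumE.
have -> : 2 * x 0 j = \sum_(i < N) (2 * x 0 i * (i == j)%:R).
  rewrite (bigD1 j)//= eqxx mulr1 big1 ?addr0// => i /negbTE ->.
  by rewrite mulr0.
apply: is_derive_sum => i.
have := is_derive_coord x (delta_mx 0 j) i.
rewrite mxE eqxx /= => D.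
apply: (@is_derive_comp1 _ _ (fun y : 'rV[R]_N => y 0 i) (fun z => z ^+ 2)).
by apply: is_derive_eq; rewrite /GRing.scale/=; ring.
Qed.

Lemma continuous_sqnorm : continuous sqnorm.
Proof.
move=> x; apply: differentiable_continuous.
have -> : sqnorm = \sum_(i < N) (fun y : 'rV[R]_N => y 0 i ^+ 2).
  by apply/funext => y; rewrite fct_sumE.
apply: differentiable_sum => i.
exact: (differentiableM (differentiable_coord x 0 i) (differentiable_coord x 0 i)).
Qed.

Section derivatives.
Variables (g g1 : R -> R) (x : 'rV[R]_N).
(** Assumed only near [x]: for uniqueness, [g] is a profile composed with the square root, known to
    be derivable only for 0 < s < rad^2. *)
Hypothesis Dg : \forall y \near x, is_derive (sqnorm y) 1 g (g1 (sqnorm y)).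
Let w := fun y => g (sqnorm y).

Lemma is_derive_radial i : is_derive x (delta_mx 0 i) w (2 * x 0 i * g1 (sqnorm x)).
Proof.
rewrite mulrC; apply: is_derive_comp1; last exact: is_derive_sqnorm.
exact: (nbhs_singleton Dg).
Qed.

(** Equality on a neighbourhood is what allows a second differentiation. *)
Lemma near_partial_radial i :
  \forall y \near x, partial i w y = 2 * y 0 i * g1 (sqnorm y).
Proof.
near=> y; rewrite /partial; apply: derive_val.
rewrite mulrC; apply: is_derive_comp1; last exact: is_derive_sqnorm.
by near: y.
Unshelve. all: by end_near. Qed.

Lemma is_derive_partial_radial (g2 : R) i j : is_derive (sqnorm x) 1 g1 g2 ->
  is_derive x (delta_mx 0 j) (partial i w)
    (2 * (i == j)%:R * g1 (sqnorm x) + 4 * (x 0 i * x 0 j) * g2).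
Proof.
move=> Dg1.
apply: (@near_eq_is_derive _ _ _ (fun y => 2 * y 0 i * g1 (sqnorm y))).
  by near do apply/esym; exact: near_partial_radial.
have := is_derive_coord x (delta_mx 0 j) i; rewrite mxE eqxx /= => D1.
have D2 := is_derive_comp1 _ _ _ _ _ _ _ _ Dg1 (is_derive_sqnorm x j).
by apply: is_derive_eq; rewrite /GRing.scale/=; ring.
Unshelve. all: by end_near. Qed.

Lemma laplacian_radial (g2 : R) : is_derive (sqnorm x) 1 g1 g2 ->
  laplacian w x = 4 * sqnorm x * g2 + 2 * N%:R * g1 (sqnorm x).
Proof.
move=> Dg1; rewrite /laplacian.
under eq_bigr do rewrite {1}/partial
  (@derive_val _ _ _ _ _ _ _ (is_derive_partial_radial _ _ _ Dg1)) eqxx mulr1.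
rewrite big_split/= sumr_const card_ord -mulr_suml -mulr_sumr.
by rewrite -mulr_natr -/(sqnorm x); ring.
Qed.

End derivatives.

(** All partial derivatives are polynomials in the coordinates times [g1] or [g2] at the squared
    norm, so continuity holds at the origin too. *)
Lemma C2_radial (D : set 'rV[R]_N) (g g1 g2 : R -> R) :
  (forall s : R, is_derive s 1 g (g1 s)) -> (forall s : R, is_derive s 1 g1 (g2 s)) ->
  continuous g2 -> C2_open D (fun y => g (sqnorm y)).
Proof.
move=> Dg Dg1 cg2.
have Dgx x : \forall y \near x, is_derive (sqnorm y) 1 g (g1 (sqnorm y)).
  by near=> y.
have csq (h : R -> R) : continuous h -> continuous (fun y => h (sqnorm y)).
  by move=> ch x; apply: continuous_comp; [exact: continuous_sqnorm|exact: ch].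
have cD (h h1 : R -> R) : (forall s : R, is_derive s 1 h (h1 s)) -> continuous h.
  by move=> Dh s; apply/differentiable_continuous/derivable1_diffP; have [] := Dh s.
have cg := csq _ (cD _ _ Dg); have cg1 := csq _ (cD _ _ Dg1).
have pE i : partial i (fun y => g (sqnorm y)) = fun y => 2 * y 0 i * g1 (sqnorm y).
  by apply/funext => y; exact: (nbhs_singleton (near_partial_radial _ _ _ (Dgx y) i)).
have ppE i j : partial j (partial i (fun y => g (sqnorm y))) =
    fun y => 2 * (i == j)%:R * g1 (sqnorm y) + 4 * (y 0 i * y 0 j) * g2 (sqnorm y).
  apply/funext => y; rewrite {1}/partial; apply: derive_val.
  exact: is_derive_partial_radial.
have cM (h k : 'rV[R]_N -> R) :
    continuous h -> continuous k -> continuous (fun y => h y * k y).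
  by move=> ch ck y; exact: continuousM (ch y) (ck y).
have cC (a : R) : continuous (fun _ : 'rV[R]_N => a) by exact: cst_continuous.
have cX i : continuous (fun y : 'rV[R]_N => y 0 i) by exact: coord_continuous.
split.
- by move=> x _; exact: cg.
- move=> i x _; split.
    by have [] := is_derive_radial _ _ _ (Dgx x) i.
  by rewrite pE; apply: (cM _ _ (cM _ _ (cC 2) (cX i)) cg1).
- move=> i j x _; split.
    by have [] := is_derive_partial_radial _ _ _ (Dgx x) _ i j (Dg1 _).
  rewrite ppE; apply: continuousD.
    exact: (cM _ _ (cC (2 * (i == j)%:R)) cg1).
  apply: (cM _ _ (cM _ _ (cC 4) (cM _ _ _ _)) (csq _ cg2)); exact: cX.
Unshelve. all: by end_near. Qed.

End radial_functions.

(** * Energy estimate for a linear second-order equation with zero initial data *)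

Lemma linear_ode2_eq0 (R : realType) (b C : R) (d d1 d2 m k : R -> R) :
  {within `[0, b], continuous d} -> {within `[0, b], continuous d1} ->
  (forall x, x \in `]0, b[ -> is_derive x 1 d (d1 x)) ->
  (forall x, x \in `]0, b[ -> is_derive x 1 d1 (d2 x)) ->
  (forall x, x \in `]0, b[ ->
    [/\ d2 x = k x * d x - m x * d1 x, 0 <= m x & 0 <= k x <= C]) ->
  d 0 = 0 -> d1 0 = 0 -> forall x, x \in `[0, b] -> d x = 0.
Proof.
move=> cd cd1 Dd Dd1 ode d00 d10 x xb.
(* The cross term is 2 (k + 1) d d1, at most (k + 1)(d^2 + d1^2); the rate C + 1 absorbs it because
   k <= C. *)
pose F y := (d y ^+ 2 + d1 y ^+ 2) * expR (- (C + 1) * y).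
have DF y : y \in `]0, b[ -> is_derive y 1 F
    ((2 * d y * d1 y + 2 * d1 y * d2 y - (C + 1) * (d y ^+ 2 + d1 y ^+ 2)) *
     expR (- (C + 1) * y)).
  move=> yb; have := Dd _ yb; have := Dd1 _ yb => H1 H2.
  rewrite /F; apply: is_derive_eq.
  rewrite /GRing.scale/=; ring.
have FF : F x <= F 0.
  apply: (@ler0_derive1_le_cc _ F 0 b) => //.
  - by move=> y /DF[].
  - move=> y yb; rewrite derive1E; have := DF _ yb => -[_ ->].
    rewrite pmulr_lle0 ?expR_gt0//.
    have [-> m0 /andP[k0 kC]] := ode _ yb.
    (* Completing the square shows the derivative as minus a sum of three nonnegative terms. *)
    rewrite [leLHS](_ : _ = - ((k y + 1) * (d y - d1 y) ^+ 2
      + 2 * (m y * d1 y ^+ 2) + (C - k y) * (d y ^+ 2 + d1 y ^+ 2))); last by ring.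
    have := sqr_ge0 (d y - d1 y); have := sqr_ge0 (d y); have := sqr_ge0 (d1 y).
    move: (d y ^+ 2) (d1 y ^+ 2) ((d y - d1 y) ^+ 2) => s s1 s2 s0 s10 s20.
    have h1 : 0 <= (k y + 1) * s2 by rewrite mulr_ge0// addr_ge0.
    have h2 : 0 <= m y * s1 by rewrite mulr_ge0.
    have h3 : 0 <= (C - k y) * (s + s1) by rewrite mulr_ge0 ?subr_ge0 ?addr_ge0.
    lra.
  - apply/subspace_continuousP => y yb.
    have /subspace_continuousP/(_ _ yb) cdy := cd.
    have /subspace_continuousP/(_ _ yb) cd1y := cd1.
    apply: cvgM; first by apply: cvgD; apply: cvgM.
    apply: cvg_within_filter.
    apply: (@continuous_comp _ _ _ (fun z => - (C + 1) * z)); last exact: continuous_expR.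
    by apply: cvgMr; exact: cvg_id.
  - by rewrite in_itv/= lexx; move: xb; rewrite in_itv/= => /andP[/le_trans]; apply.
  - by move: xb; rewrite in_itv/= => /andP[].
move: FF; rewrite /F d00 d10 expr0n/= addr0 mul0r pmulr_lle0 ?expR_gt0// => F0.
apply/eqP; rewrite -sqrf_eq0 eq_le sqr_ge0 andbT.
by apply: le_trans F0; rewrite lerDl sqr_ge0.
Qed.

(** * From the equation on the ball to the profile equation, and uniqueness *)

Section uniqueness.
Variables (R : realType) (N : nat).
Implicit Types (v : R -> R) (r : R).

Definition axis (i : 'I_N) r : 'rV[R]_N := r *: delta_mx 0 i.

Lemma sqnorm_axis i r : sqnorm R N (axis i r) = r ^+ 2.
Proof.
rewrite /sqnorm (bigD1 i)//= !mxE !eqxx mulr1 big1 ?addr0// => j /negbTE ji.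
by rewrite !mxE ji andbF mulr0 expr0n.
Qed.

Lemma enorm_axis i r : enorm (axis i r) = `|r|.
Proof. by rewrite -sqrtr_sqr -(sqnorm_axis i). Qed.

Variables (rad sigma alpha : R).
Hypotheses (hN : (1 <= N)%N) (rad0 : 0 < rad).
Let I : set R := `[0, rad]%classic.

Lemma radial_solution_derive0 v :
  positive_radial_solution N rad sigma alpha v -> derive_in I v 0 = 0.
Proof.
move=> [_ [_ Cw _] _ _ _]; pose i := Ordinal hN.
have [|dw _] := Cw i 0.
  have <- : axis i 0 = 0 by rewrite /axis scale0r.
  by rewrite /eball /= enorm_axis normr0.
(* [f] is the radial function restricted to an axis, so [L] is its derivative at 0; evenness then
   gives - L = L. *)
pose f (h : R) : R := v `|h|; pose L := 'D_(delta_mx 0 i) (fun x => v (enorm x)) 0.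
have Df : is_derive (0 : R) 1 f L.
  have /is_derive_lineP := derivableP dw.
  by under eq_fun do rewrite addr0 enorm_axis.
have Lf0 : - L = L.
  have Df' : is_derive (0 : R) 1 (fun h => f (- h)) (- L).
    have : is_derive (0 : R) 1 (f \o -%R) (L * -1).
      by apply: is_derive1_comp; rewrite oppr0.
    by rewrite mulrN1.
  have fN : (fun h => f (- h)) = f by apply/funext => h; rewrite /f normrN.
  rewrite fN in Df'.
  by rewrite -(@derive_val _ _ _ _ _ _ _ Df') (@derive_val _ _ _ _ _ _ _ Df).
have L0 : L = 0 by lra.
have I0 : I 0 by rewrite /I /= in_itv/= lexx ltW.
apply: (derive_inP _ _ _ rad0 _ _ _ I0 _).2.
apply: (eq_diff_quot_cvg _ _ _ f) => //.
  by move=> y; rewrite inE /= in_itv/= => /andP[y0 _]; rewrite /f ger0_norm.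
by apply: cvg_within_filter; rewrite L0 in Df; exact: is_derive_diff_quot.
Qed.

(** The equation is evaluated at the point of an axis at distance [r], away from the singularity of
    the square root. *)
Lemma radial_solution_ode v r : r \in `]0, rad[ ->
  positive_radial_solution N rad sigma alpha v ->
  derive_in I (derive_in I v) r =
  r ^+ 2 / sigma ^+ 4 * v r - (N%:R - 1) / r * derive_in I v r.
Proof.
rewrite in_itv/= => /andP[r0 rrad] [[C1 C2 _] _ eqn _ _].
pose i := Ordinal hN; pose x := axis i r.
set v1 := derive_in I v; set v2 := derive_in I v1.
have Dv s : 0 < s < rad -> is_derive s 1 v (v1 s).
  move=> srad; apply: derivable_in_is_derive => //; apply: C1.
  by rewrite /= in_itv/=; case/andP: srad => /ltW -> /ltW ->.
have Dv1 : is_derive r 1 v1 (v2 r).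
  apply: derivable_in_is_derive; rewrite ?r0//; apply: C2.
  by rewrite /= in_itv/= !ltW.
pose g s := v (Num.sqrt s); pose g1 s := v1 (Num.sqrt s) * (2 * Num.sqrt s)^-1.
have xr : sqnorm R N x = r ^+ 2 by exact: sqnorm_axis.
have sr : Num.sqrt (r ^+ 2) = r by rewrite sqrtr_sqr gtr0_norm.
have Dg s : 0 < s < rad ^+ 2 -> is_derive s 1 g (g1 s).
  move=> /andP[s0 srad]; have Ds := is_derive1_sqrt s0.
  apply: (@is_derive1_comp _ v Num.sqrt).
  apply: Dv; rewrite sqrtr_gt0 s0/=.
  by rewrite -[ltRHS](gtr0_norm rad0) -sqrtr_sqr ltr_sqrt// exprn_gt0.
have Dgx : \forall y \near x, is_derive (sqnorm R N y) 1 g (g1 (sqnorm R N y)).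
  have s0 : \forall y \near x, 0 < sqnorm R N y.
    by apply: (cvgr_gt _ (continuous_sqnorm R N x)); rewrite xr exprn_gt0.
  have srad : \forall y \near x, sqnorm R N y < rad ^+ 2.
    apply: (cvgr_lt _ (continuous_sqnorm R N x)); rewrite xr.
    by rewrite ltrXn2r// ltW.
  by near=> y; apply: Dg; apply/andP; split; near: y.
(* Second derivative of v(sqrt s) at s = r^2. In 4 s g'' + 2 N g' it gives v'' - v'/r + N v'/r,
   hence the coefficient (N - 1)/r. *)
have Dg1 : is_derive (sqnorm R N x) 1 g1
    (v2 r / (4 * r ^+ 2) - v1 r / (4 * r ^+ 3)).
  rewrite xr; have r20 : 0 < r ^+ 2 by rewrite exprn_gt0.
  have := is_derive1_sqrt r20; rewrite sr => Ds.
  have Dv1s : is_derive (Num.sqrt (r ^+ 2)) 1 v1 (v2 r) by rewrite sr.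
  have D1 : is_derive (r ^+ 2) 1 (v1 \o Num.sqrt) (v2 r * (2 * r)^-1).
    exact: is_derive1_comp.
  have D2 : is_derive (r ^+ 2) 1 (fun s => (2 * Num.sqrt s)^-1)
      (- (2 * r) ^- 2 *: (2 * (2 * r)^-1)).
    have D3 : is_derive (r ^+ 2) 1 (fun s => 2 * Num.sqrt s) (2 * (2 * r)^-1).
      by apply: is_derive_eq; rewrite /GRing.scale/=; ring.
    by have := is_deriveV _ D3; rewrite sr; apply; rewrite mulf_neq0 ?gt_eqF.
  rewrite /g1; apply: is_derive_eq; rewrite /GRing.scale/= sr.
  by field; rewrite gt_eqF.
have Bx : eball rad x by rewrite /eball /= enorm_axis gtr0_norm.
have := eqn _ Bx.
rewrite (laplacian_radial _ _ _ _ _ Dgx _ Dg1) xr enorm_axis gtr0_norm// /g1 sr.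
have rn0 : r != 0 by rewrite gt_eqF.
move=> E; rewrite [r ^+ 2 / sigma ^+ 4](_ : _ = 1 / sigma ^+ 4 * r ^+ 2); last first.
  by rewrite mul1r mulrC.
by rewrite -E; field.
Unshelve. all: by end_near. Qed.

Lemma radial_solution_unique u v :
  positive_radial_solution N rad sigma alpha u ->
  positive_radial_solution N rad sigma alpha v ->
  forall r, r \in `[0, rad] -> v r = u r.
Proof.
move=> hu hv r rI; apply/eqP; rewrite -subr_eq0; apply/eqP.
have [[Cu Cu1 _] _ _ u0 _] := hu; have [[Cv Cv1 _] _ _ v0 _] := hv.
set u1 := derive_in I u in Cu1; set v1 := derive_in I v in Cv1.
have sub s : s \in `]0, rad[ -> I s.
  by rewrite /I /= !in_itv/= => /andP[/ltW -> /ltW ->].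
have Din f s : s \in `]0, rad[ -> derivable_in I f s ->
  is_derive s 1 f (derive_in I f s).
  by move=> sI; apply: derivable_in_is_derive; move: sI; rewrite in_itv.
have cB (f g : R -> R) : {within I, continuous f} -> {within I, continuous g} ->
    {within I, continuous (fun y => f y - g y)}.
  move=> /subspace_continuousP cf /subspace_continuousP cg.
  by apply/subspace_continuousP => y Iy; apply: cvgB; [exact: cf|exact: cg].
have cI := derivable_in_within_continuous _ _ _ rad0.
(* Here k = y^2 / sigma^4 is at most its value at [rad], and m = (N - 1)/y is nonnegative since N >=
   1. *)
apply: (@linear_ode2_eq0 _ rad (rad ^+ 2 / sigma ^+ 4) (fun y => v y - u y)
  (fun y => v1 y - u1 y)
  (fun y => derive_in I v1 y - derive_in I u1 y) (fun y => (N%:R - 1) / y)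
  (fun y => y ^+ 2 / sigma ^+ 4)) => //.
- by apply: cB; exact: cI.
- by apply: cB; exact: cI.
- move=> s sI; have := Din _ _ sI (Cv _ (sub _ sI)).
  by have := Din _ _ sI (Cu _ (sub _ sI)) => *; exact: is_deriveB.
- move=> s sI; have := Din _ _ sI (Cv1 _ (sub _ sI)).
  by have := Din _ _ sI (Cu1 _ (sub _ sI)) => *; exact: is_deriveB.
- move=> s sI; rewrite (radial_solution_ode _ _ sI hv) (radial_solution_ode _ _ sI hu).
  move: sI; rewrite in_itv/= => /andP[s0 srad].
  have s40 : 0 <= (sigma ^+ 4)^-1 by rewrite invr_ge0 exprn_even_ge0.
  split; first by rewrite /u1 /v1; ring.
    by rewrite divr_ge0 ?subr_ge0 ?ler1n// ltW.
  rewrite mulr_ge0 ?sqr_ge0//= ler_wpM2r// lerXn2r ?nnegrE ?ltW//.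
- by rewrite u0 v0 subrr.
- by rewrite /u1 /v1 !radial_solution_derive0// subrr.
Qed.

End uniqueness.

(** * The explicit solution: derivatives, signs, bounds and expansions *)

Section solution.
Variables (R : realType) (N : nat) (sigma alpha : R).
Hypotheses (sigma0 : sigma != 0) (alpha0 : 0 < alpha).
Implicit Types r s x : R.
Let c : R ^nat := profile_coef R N.
Let dc := pseries_diffs c.
Let ddc := pseries_diffs dc.

Let cb : fact_bounded R c. Proof. exact: fact_bounded_profile_coef. Qed.
Let dcb : fact_bounded R dc. Proof. exact: fact_bounded_diffs. Qed.
Let ddcb : fact_bounded R ddc. Proof. exact: fact_bounded_diffs. Qed.
Let c_ge0 j : 0 <= c j. Proof. exact/ltW/profile_coef_gt0. Qed.
Let dc_ge0 j : 0 <= dc j. Proof. exact: pseries_diffs_ge0. Qed.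
Let ddc_ge0 j : 0 <= ddc j. Proof. exact: pseries_diffs_ge0. Qed.

Let sigma40 : 0 < sigma ^+ 4.
Proof. by rewrite exprn_even_gt0. Qed.

(** The variable z of H at |x| = r. *)
Definition scaled (r : R) := r ^+ 4 / (4 * sigma ^+ 4).
Definition sol (r : R) := alpha * psum R c (scaled r).
(** [sol1] and [sol2] are the chain-rule derivatives of [sol] on the whole line; r^3 / sigma^4 is
    the derivative of [scaled]. *)
Definition sol1 (r : R) := alpha * (r ^+ 3 / sigma ^+ 4) * psum R dc (scaled r).
Definition sol2 (r : R) := alpha * (3 * r ^+ 2 / sigma ^+ 4 * psum R dc (scaled r) +
  (r ^+ 3 / sigma ^+ 4) ^+ 2 * psum R ddc (scaled r)).

Lemma scaled_ge0 r : 0 <= scaled r.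
Proof. by apply: divr_ge0; [exact: exprn_even_ge0|apply: mulr_ge0 => //; exact: ltW]. Qed.

Lemma scaledE r : scaled r = (r ^+ 2 / (2 * sigma ^+ 2)) ^+ 2.
Proof. by rewrite /scaled; field. Qed.

Lemma is_derive_psum_comp e q x (q' : R) : fact_bounded R e -> is_derive x 1 q q' ->
  is_derive x 1 (fun r => psum R e (q r)) (psum R (pseries_diffs e) (q x) * q').
Proof.
move=> eb Dq; apply: (@is_derive1_comp _ (psum R e) q) => //.
exact: is_derive_psum.
Qed.

Lemma is_derive_scaled r : is_derive r 1 scaled (r ^+ 3 / sigma ^+ 4).
Proof.
rewrite /scaled; apply: is_derive_eq; rewrite /GRing.scale/=.
by field.
Qed.

Lemma is_derive_sol r : is_derive r 1 sol (sol1 r).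
Proof.
have D := is_derive_psum_comp _ _ _ _ cb (is_derive_scaled r).
by rewrite /sol; apply: is_derive_eq; rewrite /GRing.scale/= /sol1; ring.
Qed.

Lemma is_derive_sol1 r : is_derive r 1 sol1 (sol2 r).
Proof.
have D := is_derive_psum_comp _ _ _ _ dcb (is_derive_scaled r).
rewrite /sol1; apply: is_derive_eq; rewrite /GRing.scale/= /sol2.
by ring.
Qed.

Lemma continuous_sol2 : continuous sol2.
Proof.
have cs : continuous scaled.
  move=> r; apply/differentiable_continuous/derivable1_diffP.
  by have [] := is_derive_scaled r.
have cp e : fact_bounded R e -> continuous (fun r => psum R e (scaled r)).
  by move=> eb r; apply: continuous_comp; [exact: cs|exact: continuous_psum].
have cX n : continuous (fun r : R => r ^+ n) by exact: exprn_continuous.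
move=> r; apply: cvgMr; apply: cvgD; apply: cvgM; try exact: cp.
  by apply: cvgMl; apply: cvgMr; exact: cX.
by apply: cvgM; apply: cvgMl; exact: cX.
Qed.

Lemma sol1_gt0 r : 0 < r -> 0 < sol1 r.
Proof.
move=> r0; rewrite mulr_gt0//.
  by rewrite mulr_gt0// mulr_gt0 ?exprn_gt0// invr_gt0.
apply: lt_le_trans (psum_ge_coef0 _ _ _ dcb dc_ge0 (scaled_ge0 r)).
(* The constant coefficient of H' is [c 1], which is positive. *)
by rewrite /dc /pseries_diffs mul1r profile_coef_gt0.
Qed.

Lemma sol2_ge0 r : 0 <= sol2 r.
Proof.
rewrite mulr_ge0 ?(ltW alpha0)// addr_ge0//.
  rewrite mulr_ge0//.
    by rewrite mulr_ge0 ?invr_ge0 ?(ltW sigma40)// mulr_ge0// sqr_ge0.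
  exact: le_trans (psum_ge_coef0 _ _ _ dcb dc_ge0 (scaled_ge0 r)).
rewrite mulr_ge0 ?sqr_ge0//.
exact: le_trans (psum_ge_coef0 _ _ _ ddcb ddc_ge0 (scaled_ge0 r)).
Qed.

Lemma sol_gt0 r : 0 < sol r.
Proof.
rewrite mulr_gt0//.
by apply: lt_le_trans (psum_ge_coef0 _ _ _ cb c_ge0 (scaled_ge0 r)); exact: profile_coef_gt0.
Qed.

(** [psum_le_expR] with a = 1 and b = 1/(N+2). *)
Lemma sol_le r :
  sol r <= alpha * expR (r ^+ 4 / (4 * sigma ^+ 4 * (N%:R + 2))).
Proof.
have N2 : N%:R + 2 != 0 :> R by rewrite gt_eqF// ltr_wpDl.
rewrite ler_wpM2l ?(ltW alpha0)// [X in expR X](_ : _ = (N%:R + 2)^-1 * scaled r).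
  rewrite -[leRHS]mul1r; apply: psum_le_expR => //; first exact: scaled_ge0.
  by move=> j; rewrite mul1r; exact: profile_coef_le.
by rewrite /scaled; move: (N%:R + 2) N2 => m m0; field; rewrite m0 sigma0.
Qed.

(** [psum_le_expR] for H', with a = b = 1/(N+2). *)
Lemma sol1_le r : 0 <= r ->
  sol1 r <= alpha * r ^+ 3 / (sigma ^+ 4 * (N%:R + 2)) *
    expR (r ^+ 4 / (4 * sigma ^+ 4 * (N%:R + 2))).
Proof.
move=> r0; have N2 : N%:R + 2 != 0 :> R by rewrite gt_eqF// ltr_wpDl.
have s4 : sigma ^+ 4 != 0 by rewrite gt_eqF.
rewrite [leRHS](_ : _ = alpha * (r ^+ 3 / sigma ^+ 4) *
  ((N%:R + 2)^-1 * expR ((N%:R + 2)^-1 * scaled r))); last first.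
  rewrite /scaled [X in expR X](_ : _ = (N%:R + 2)^-1 * (r ^+ 4 / (4 * sigma ^+ 4))).
    by move: (N%:R + 2) N2 (expR _) => m m0 E; field; rewrite m0 sigma0.
  by move: (N%:R + 2) N2 => m m0; field; rewrite m0 sigma0.
rewrite ler_wpM2l//.
  by rewrite mulr_ge0 ?(ltW alpha0)// mulr_ge0 ?exprn_ge0// invr_ge0 ltW.
by apply: psum_le_expR => //; [exact: scaled_ge0|exact: dprofile_coef_le].
Qed.

(** Convergence is stated as well, since the infinite sum is a [lim] and is meaningful only with
    it. *)
Lemma sol_series r :
  cvgn (fun n => \sum_(1 <= j < n) profile_term N sigma r j) /\
  sol r = alpha * (1 + \big[+%R/0]_(1 <= j <oo) profile_term N sigma r j).
Proof.
have E n : \sum_(1 <= j < n.+1) profile_term N sigma r j =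
    pseries c (scaled r) n.+1 - 1.
  rewrite /pseries /series /= (big_ltn (ltn0Sn n)) expr0 mulr1.
  rewrite {1}/c /profile_coef den0 invr1 addrAC subrr add0r.
  by apply: eq_bigr => j _; rewrite /profile_term div1r scaledE -exprM.
have L : (fun n => \sum_(1 <= j < n) profile_term N sigma r j) @ \oo -->
    psum R c (scaled r) - 1.
  rewrite -(cvg_shiftS (fun n => \sum_(1 <= j < n) profile_term N sigma r j)).
  under eq_fun do rewrite E; apply: cvgB; last exact: cvg_cst.
  rewrite (cvg_shiftS (pseries c (scaled r))); exact: is_cvg_pseries_fact.
split; first by apply/cvg_ex; exists (psum R c (scaled r) - 1).
by rewrite (cvg_lim _ L)// addrC subrK.
Qed.

Lemma sol1_series r :
  cvgn (fun n => \sum_(1 <= j < n) dprofile_term N sigma r j) /\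
  sol1 r = alpha * \big[+%R/0]_(1 <= j <oo) dprofile_term N sigma r j.
Proof.
(* With j replaced by j+1 the exponent is 2j + 1; its extra factor r^2/(2 sigma^2) times 4(j+1)r/(2
   sigma^2) is (j+1) r^3/sigma^4. *)
have E n : \sum_(1 <= j < n.+1) dprofile_term N sigma r j =
    r ^+ 3 / sigma ^+ 4 * pseries dc (scaled r) n.
  rewrite /pseries /series /= big_add1/= mulr_sumr.
  apply: eq_bigr => j _; rewrite /dprofile_term scaledE -exprM.
  rewrite [(2 * j.+1 - 1)%N](_ : _ = (2 * j).+1); last by rewrite mulnS.
  rewrite [_ ^+ (2 * j).+1]exprS /dc /pseries_diffs /c /profile_coef.
  have := den_gt0 R N j.+1; move: (den R N j.+1) (_ ^+ (2 * j)) => D Z D0.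
  by field; rewrite sigma0 gt_eqF.
have L : (fun n => \sum_(1 <= j < n) dprofile_term N sigma r j) @ \oo -->
    r ^+ 3 / sigma ^+ 4 * psum R dc (scaled r).
  rewrite -(cvg_shiftS (fun n => \sum_(1 <= j < n) dprofile_term N sigma r j)).
  by under eq_fun do rewrite E; apply: cvgMr; exact: is_cvg_pseries_fact.
split; first by apply/cvg_ex; exists (r ^+ 3 / sigma ^+ 4 * psum R dc (scaled r)).
by rewrite (cvg_lim _ L)// mulrA.
Qed.

Variable rad : R.
Hypothesis rad0 : 0 < rad.
Let I : set R := `[0, rad]%classic.

Lemma derive_in_sol r : I r -> derivable_in I sol r /\ derive_in I sol r = sol1 r.
Proof. by move=> Ir; apply: is_derive_derive_in => //; exact: is_derive_sol. Qed.

Lemma derive_in2_sol r : I r ->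
  derivable_in I (derive_in I sol) r /\ derive_in I (derive_in I sol) r = sol2 r.
Proof.
move=> Ir; apply: derive_inP => //.
(* The relative derivative of [sol] is known to be [sol1] only on the segment, which is all the
   quotient sees. *)
apply: (eq_diff_quot_cvg _ _ _ sol1) => //.
  by move=> y /set_mem Iy; rewrite (derive_in_sol _ Iy).2.
by apply: cvg_within_filter; apply: is_derive_diff_quot; exact: is_derive_sol1.
Qed.

Lemma sol_increasing : {in `[0, rad] &, {homo sol : r s / r < s}}.
Proof.
have D r := is_derive_sol r.
apply: gtr0_derive1_lt_cc.
- by move=> x _; have [] := D x.
- move=> x; rewrite in_itv/= => /andP[x0 _].
  by rewrite derive1E (@derive_val _ _ _ _ _ _ _ (D x)) sol1_gt0.
- by apply: derivable_within_continuous => x _; have [] := D x.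
Qed.

Local Open Scope convex_scope.

Lemma sol_convex : convex_function I sol.
Proof.
have D1 : 'D_1 sol = sol1.
  by apply/funext => r; apply: derive_val; exact: is_derive_sol.
have D2 : 'D_1 sol1 = sol2.
  by apply/funext => r; apply: derive_val; exact: is_derive_sol1.
have cs x : {for x, continuous sol}.
  by apply/differentiable_continuous/derivable1_diffP; have [] := is_derive_sol x.
(* The second-derivative criterion takes ordered endpoints; [convC] swaps them in the other case. *)
have H (x y : R^o) (t : {i01 R}) : x <= y ->
    sol (x <| t |> y) <= (sol x : R^o) <| t |> (sol y : R^o).
  move=> xy; apply: second_derivative_convex => //.
  - move=> z _; rewrite D1; apply: le_trans (sol2_ge0 z) _.
    by rewrite le_eqVlt -D2 eqxx.
  - by apply: cvg_at_left_filter; exact: cs.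
  - by apply: cvg_at_right_filter; exact: cs.
  - by move=> z _; have [] := is_derive_sol z.
  - by move=> z _; rewrite D1; have [] := is_derive_sol1 z.
move=> t x y _ _; have [xy|/ltW yx] := leP x y; first exact: H.
by rewrite convC [leRHS]convC; exact: H.
Qed.

Local Close Scope convex_scope.

Lemma sol_radial_solution : positive_radial_solution N rad sigma alpha sol.
Proof.
(* In the variable s = |x|^2 the argument of H is a polynomial, so no square root is differentiated
   at the origin. *)
pose q s : R := s ^+ 2 / (4 * sigma ^+ 4).
pose g s := alpha * psum R c (q s).
pose g1 s := alpha * (s / (2 * sigma ^+ 4)) * psum R dc (q s).
pose g2 s := alpha * ((2 * sigma ^+ 4)^-1 * psum R dc (q s) +
  (s / (2 * sigma ^+ 4)) ^+ 2 * psum R ddc (q s)).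
have s4 : sigma ^+ 4 != 0 by rewrite gt_eqF.
have Dq s : is_derive s 1 q (s / (2 * sigma ^+ 4)).
  by rewrite /q; apply: is_derive_eq; rewrite /GRing.scale/=; field.
have Dg s : is_derive s 1 g (g1 s).
  have D := is_derive_psum_comp _ _ _ _ cb (Dq s).
  by rewrite /g; apply: is_derive_eq; rewrite /GRing.scale/= /g1; ring.
have Dg1 s : is_derive s 1 g1 (g2 s).
  have D := is_derive_psum_comp _ _ _ _ dcb (Dq s).
  by rewrite /g1; apply: is_derive_eq; rewrite /GRing.scale/= /g2; ring.
have cg2 : continuous g2.
  have cp e : fact_bounded R e -> continuous (fun r => psum R e (q r)).
    move=> eb r; apply/differentiable_continuous/derivable1_diffP.
    by have [] := is_derive_psum_comp _ _ _ _ eb (Dq r).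
  move=> s; apply: cvgMr; apply: cvgD; first by apply: cvgMr; exact: cp.
  apply: cvgM; last exact: cp.
  by apply: cvgM; apply: cvgMl; exact: cvg_id.
have wE : (fun x : 'rV[R]_N => sol (enorm x)) = fun x : 'rV[R]_N => g (sqnorm R N x).
  apply/funext => x.
  by rewrite /sol /g /q -enorm_sqr -exprM.
split.
- split.
  + by move=> r Ir; case: (derive_in_sol _ Ir).
  + by move=> r Ir; case: (derive_in2_sol _ Ir).
  + apply: (@subspace_eq_continuous _ _ _ sol2).
      by move=> r /set_mem Ir; exact: (esym (derive_in2_sol _ Ir).2).
    exact/continuous_subspaceT/continuous_sol2.
- by rewrite wE; exact: C2_radial Dg Dg1 cg2.
- move=> x _.
  have Dgx : \forall y \near x, is_derive (sqnorm R N y) 1 g (g1 (sqnorm R N y)).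
    by near=> y.
  rewrite wE (laplacian_radial _ _ _ _ _ Dgx _ (Dg1 _)).
  rewrite enorm_sqr [sol _](congr1 (@^~ x) wE).
  (* With z = q(S), 4 S g'' + 2 N g' equals alpha S / sigma^4 times 4 z H'' + (N + 2) H', that is,
     times H. *)
  have := profile_series_ode R N (q (sqnorm R N x)); rewrite -/c -/dc -/ddc.
  rewrite /g1 /g2 /g; set S := sqnorm R N x => <-.
  move: (psum R dc (q S)) (psum R ddc (q S)) (N%:R : R) => A B n.
  by rewrite /q; field.
- by rewrite /sol /scaled expr0n/= mul0r psum0 /c /profile_coef den0 invr1 mulr1.
- by move=> r _; exact: sol_gt0.
Unshelve. all: by end_near. Qed.

End solution.

(** * Existence, uniqueness, shape, expansions and bounds combined *)

Theorem theorem3p1 (R : realType) (N : nat) (rad sigma alpha : R)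
    (hN : (1 <= N)%N) (hrad : 0 < rad) (hsigma : sigma != 0)
    (halpha : 0 < alpha) :
  exists u : R -> R,
    let u' := derive_in `[0, rad]%classic u in
    [/\ positive_radial_solution N rad sigma alpha u
      , forall v : R -> R, positive_radial_solution N rad sigma alpha v ->
          forall r, r \in `[0, rad] -> v r = u r
      & [/\ convex_function `[0, rad]%classic u,
            {in `[0, rad] &, {homo u : r s / r < s}}
          & u' 0 = 0]] /\
    forall r, r \in `[0, rad] ->
      [/\ cvgn (fun n => \sum_(1 <= j < n) profile_term N sigma r j) /\
          u r = alpha *
            (1 + \big[+%R/0]_(1 <= j <oo) profile_term N sigma r j),
          cvgn (fun n => \sum_(1 <= j < n) dprofile_term N sigma r j) /\
          u' r = alpha * \big[+%R/0]_(1 <= j <oo) dprofile_term N sigma r j,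
          u r <= alpha * expR (r ^+ 4 / (4 * sigma ^+ 4 * (N%:R + 2)))
        & u' r <= alpha * r ^+ 3 / (sigma ^+ 4 * (N%:R + 2)) *
                  expR (r ^+ 4 / (4 * sigma ^+ 4 * (N%:R + 2)))].
Proof.
exists (sol R N sigma alpha) => u'.
have u'E r : r \in `[0, rad] -> u' r = sol1 R N sigma alpha r.
  by move=> rI; exact: (derive_in_sol R N sigma alpha hsigma rad hrad r rI).2.
have solR := sol_radial_solution R N _ _ hsigma halpha _ hrad.
split; first split=> //.
- by move=> v; exact: radial_solution_unique solR.
- split; [exact: sol_convex|exact: sol_increasing|].
  by rewrite u'E ?in_itv/= ?lexx ?ltW// /sol1 expr0n/= mul0r mulr0 mul0r.
move=> r rI; rewrite u'E//; split.
- exact: sol_series.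
- exact: sol1_series.
- exact: sol_le.
- by apply: sol1_le => //; move: rI; rewrite in_itv/= => /andP[].
Qed.
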